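(* Let $\{x_k\}_{k\ge1}$ be generated by the SQN iteration described in the context, suppose that assumptions AS.1, AS.2, AS.3 and AS.4 (stated in the context) hold, and suppose the batch size is constant, $m_k=m$ for all $k$. Assume that the step sizes satisfy $$\sum_{k=1}^{\infty}\alpha_k=+\infty,\qquad \sum_{k=1}^{\infty}\alpha_k^2<+\infty,$$ and $\alpha_k\le \dfrac{\underline{\kappa}}{L\bar{\kappa}^2}$ for all $k$. Then $$\liminf_{k\to\infty}\|\nabla f(x_k)\|=0\quad\text{with probability }1.$$ Moreover, there exists a positive constant $M_f$ such that $\mathbb{E}[f(x_k)]\le M_f$ for all $k$.
   Context: Setting. $f(x)=\mathbb{E}[F(x,\xi)]$ for $x\in\mathbb{R}^n$, where $F:\mathbb{R}^n\times\mathbb{R}^d\to\mathbb{R}$ is continuously differentiable and possibly nonconvex and $\xi$ is a random vector in $\mathbb{R}^d$. A stochastic first-order oracle returns, for given $x$ and a sample $\xi$, a stochastic gradient $g(x,\xi)\in\mathbb{R}^n$; the distribution of $\xi$ is supported on a set $\Xi\subseteq\mathbb{R}^d$ not depending on $x$. $\|\cdot\|$ is the Euclidean norm, and $A\preceq B$ means $B-A$ is positive semidefinite. SQN (stochastic quasi-Newton) iteration. Given are $x_1\in\mathbb{R}^n$, a positive definite $H_1\in\mathbb{R}^{n\times n}$, batch sizes $m_k\ge 1$ and step sizes $\alpha_k>0$. At iteration $k=1,2,\ldots$: draw samples $\xi_k=(\xi_{k,1},\ldots,\xi_{k,m_k})$ and set $g_k=\frac1{m_k}\sum_{i=1}^{m_k}g(x_k,\xi_{k,i})$;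 generate a positive definite matrix $H_k$; set $x_{k+1}=x_k-\alpha_kH_kg_k$. Write $\xi_{[k]}=(\xi_1,\ldots,\xi_k)$. Assumptions. AS.1: $f:\mathbb{R}^n\to\mathbb{R}$ is continuously differentiable, $f(x)\ge f^{low}$ for all $x$ for some real $f^{low}$, and $\|\nabla f(x)-\nabla f(y)\|\le L\|x-y\|$ for all $x,y\in\mathbb{R}^n$. AS.2: all samples are independent, the samples of iteration $k$ are independent of $\{x_j\}_{j=1}^k$, and for each $k$ and each sample $\xi$ of iteration $k$ (expectation over that sample) $\mathbb{E}_{\xi}[g(x_k,\xi)]=\nabla f(x_k)$ and $\mathbb{E}_{\xi}[\|g(x_k,\xi)-\nabla f(x_k)\|^2]\le\sigma^2$, with $\sigma>0$. AS.3: there are positive constants $\underline{\kappa},\bar{\kappa}$ with $\underline{\kappa}I\preceq H_k\preceq\bar{\kappa}I$ for all $k$. AS.4: for every $k\ge2$, the random matrix $H_k$ depends only on $\xi_{[k-1]}$. *)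

(* Defs.v *)
From HB Require Import structures.
From mathcomp Require Import all_boot all_order all_algebra finmap.
From mathcomp Require Import all_classical all_reals all_analysis.

Set Implicit Arguments.
Unset Strict Implicit.
Unset Printing Implicit Defensive.

Import Order.TTheory GRing.Theory Num.Theory.
Import numFieldNormedType.Exports.

Local Open Scope classical_set_scope.
Local Open Scope ring_scope.

Section EuclideanSpace.
Context {R : realType} {n : nat}.

(* The library's norm on matrices is the sup norm, hence this one.  The
   topologies agree. *)
Definition norm2 (v : 'cV[R]_n) : R := Num.sqrt (\sum_i v i 0 ^+ 2).

Definition grad (f : 'cV[R]_n -> R) (x : 'cV[R]_n) : 'cV[R]_n :=
  \col_i 'D_(delta_mx i 0) (f : 'cV[R]_n -> R^o) x.

Definition psd (A : 'M[R]_n) : Prop :=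
  A^T = A /\ forall v : 'cV[R]_n, 0 <= (v^T *m A *m v) 0 0.

Definition posdef (A : 'M[R]_n) : Prop :=
  A^T = A /\ forall v : 'cV[R]_n, v != 0 -> 0 < (v^T *m A *m v) 0 0.

Definition loewner_le (A B : 'M[R]_n) : Prop := psd (B - A).

End EuclideanSpace.

(* Meant for finite-dimensional [V], where continuity of every directional
   derivative amounts to continuity of [x |-> 'd f x]. *)
Definition continuously_differentiable {R : realType} {V : normedModType R}
    (f : V -> R) : Prop :=
  (forall x, differentiable (f : V -> R^o) x) /\
  (forall v, continuous ('D_v (f : V -> R^o))).

(* [T] with its Borel sigma-algebra *)
Notation borel T := (g_sigma_algebraType (@open T)).

Section Probability.
Context {R : realType} {d} {Omega : measurableType d} (P : probability Omega R).
Context {d'} {E : measurableType d'} {I : choiceType}.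

Definition mutually_independent (X : I -> Omega -> E) : Prop :=
  forall (J : {fset I}) (B : I -> set E), (forall i, measurable (B i)) ->
    P (\bigcap_(i in [set` J]) X i @^-1` B i) =
    (\prod_(i <- J) P (X i @^-1` B i))%E.

Definition independent_classes (F G : set (set Omega)) : Prop :=
  forall A B, F A -> G B -> P (A `&` B) = (P A * P B)%E.

(* sigma-algebra on [Omega] generated by the [X i], [i] in [D] *)
Definition sigma_of (D : set I) (X : I -> Omega -> E) : set (set Omega) :=
  <<s \bigcup_(i in D) preimage_set_system setT (X i) measurable >>.

End Probability.

(* Iterations are numbered from 0: index [k] here is iteration [k + 1]. *)
Section SQN.
Context {R : realType} {dO} {Omega : measurableType dO}.
Variable P : probability Omega R.
Context {n d m : nat}.
Variables (f : 'cV[R]_n -> R) (g : 'cV[R]_n -> 'cV[R]_d -> 'cV[R]_n).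
Variable xi : nat -> 'I_m -> {RV P >-> borel 'cV[R]_d}.
Variables (H : nat -> Omega -> 'M[R]_n) (x : nat -> Omega -> 'cV[R]_n).

Definition batch_grad (k : nat) (w : Omega) : 'cV[R]_n :=
  m%:R^-1 *: \sum_(i < m) g (x k w) (xi k i w).

Definition sqn_iteration (x1 : 'cV[R]_n) (H1 : 'M[R]_n) (alpha : nat -> R) :
    Prop :=
  [/\ forall w, x 0%N w = x1,
      forall w, H 0%N w = H1,
      forall k w, posdef (H k w) &
      forall k w, x k.+1 w = x k w - alpha k *: (H k w *m batch_grad k w)].

Definition all_samples (p : nat * 'I_m) : Omega -> borel 'cV[R]_d :=
  xi p.1 p.2.

Definition smooth_bounded_below (L flow : R) : Prop :=
  [/\ continuously_differentiable f,
      forall y, flow <= f y &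
      forall y z, norm2 (grad f y - grad f z) <= L * norm2 (y - z)].

Definition independent_samples : Prop :=
  mutually_independent P all_samples /\
  forall k, independent_classes P
    (sigma_of [set j | (j <= k)%N]
       (x : nat -> Omega -> borel 'cV[R]_n))
    (sigma_of setT (fun i => xi k i : Omega -> borel 'cV[R]_d)).

(* The expectation is over the law of the sample [xi k i] alone: the iterate
   [x k w] is frozen, and the condition holds for almost every [w]. *)
Definition unbiased_oracle : Prop :=
  forall k i, {ae P, forall w, forall j : 'I_n,
    (distribution P (xi k i)).-integrable setT
      (fun s => (g (x k w) s j 0)%:E) /\
    'E_(distribution P (xi k i))[fun s => g (x k w) s j 0%R]%E =
      (grad f (x k w) j 0)%:E}.

Definition bounded_variance_oracle (sigma : R) : Prop :=
  forall k i, {ae P, forall w,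
    ('E_(distribution P (xi k i))
       [fun s => (norm2 (g (x k w) s - grad f (x k w)) ^+ 2)%R]
     <= (sigma ^+ 2)%:E)%E}.

Definition bounded_metrics (klo khi : R) : Prop :=
  forall k, {ae P, forall w,
    loewner_le klo%:M (H k w) /\ loewner_le (H k w) khi%:M}.

Definition nonanticipating_metrics : Prop :=
  forall k, (0 < k)%N -> forall B : set (borel 'M[R]_n), measurable B ->
    sigma_of [set p : nat * 'I_m | (p.1 < k)%N] all_samples (H k @^-1` B).

End SQN.

(* Main.v *)
(* By the descent lemma and |H v| <= khi |v|, one iteration decreases
   f(x_k) by at least (klo / 2) alpha_k |grad f(x_k)|^2, up to a term linear in
   the sampling noise, whose factor depends on the past only, and an
   O(alpha_k^2) multiple of the squared noise.  Given the past the noise is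
   centered with variance at most sigma^2: this is Fubini, since the past and a
   sample of iteration k have a product law.  The linear term is integrable
   because |grad f|^2 <= 2 L (f - flow).  Taking expectations and summing bounds
   E[f(x_k)] and gives E[sum_k alpha_k |grad f(x_k)|^2] < oo, so that this
   series converges almost surely and sum_k alpha_k = oo forces the liminf to
   vanish; no martingale convergence theorem is needed. *)
Require Import Defs.
From mathcomp Require Import all_boot all_order all_algebra finmap.
From mathcomp Require Import all_classical all_reals all_analysis.
From mathcomp Require Import measurable_realfun ring lra.

Import Order.TTheory GRing.Theory Num.Theory.
Import numFieldNormedType.Exports.

Local Open Scope classical_set_scope.
Local Open Scope ring_scope.

(** * Euclidean inner product, Loewner bounds and averages *)

Section Dot.
Context {R : realType} {n : nat}.
Implicit Types (u v : 'cV[R]_n) (A : 'M[R]_n).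

Definition dot u v : R := \sum_i u i 0 * v i 0.

Lemma dotE u v : dot u v = (u^T *m v) 0 0.
Proof. by rewrite mxE; apply: eq_bigr => i _; rewrite mxE. Qed.

Lemma dotC u v : dot u v = dot v u.
Proof. by apply: eq_bigr => i _; rewrite mulrC. Qed.

Lemma dotDl u1 u2 v : dot (u1 + u2) v = dot u1 v + dot u2 v.
Proof. by rewrite -big_split; apply: eq_bigr => i _; rewrite mxE mulrDl. Qed.

Lemma dotZl a u v : dot (a *: u) v = a * dot u v.
Proof. by rewrite mulr_sumr; apply: eq_bigr => i _; rewrite mxE mulrA. Qed.

Lemma dotDr u v1 v2 : dot u (v1 + v2) = dot u v1 + dot u v2.
Proof. by rewrite dotC dotDl !(dotC u). Qed.

Lemma dotZr a u v : dot u (a *: v) = a * dot u v.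
Proof. by rewrite dotC dotZl dotC. Qed.

Lemma dotNl u v : dot (- u) v = - dot u v.
Proof. by rewrite -scaleN1r dotZl mulN1r. Qed.

Lemma dotNr u v : dot u (- v) = - dot u v.
Proof. by rewrite dotC dotNl dotC. Qed.

Lemma dot_sumr (I : Type) (s : seq I) u (v : I -> 'cV[R]_n) :
  dot u (\sum_(i <- s) v i) = \sum_(i <- s) dot u (v i).
Proof.
elim: s => [|i s ih]; last by rewrite !big_cons dotDr ih.
by rewrite !big_nil /dot big1 // => i _; rewrite mxE mulr0.
Qed.

Lemma dot_ge0 v : 0 <= dot v v.
Proof. by apply: sumr_ge0 => i _; rewrite -expr2 sqr_ge0. Qed.

Lemma norm2_ge0 v : 0 <= norm2 v.
Proof. exact: sqrtr_ge0. Qed.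

Lemma norm2_sqr v : norm2 v ^+ 2 = dot v v.
Proof.
by rewrite /norm2 sqr_sqrtr ?sumr_ge0// => i _; rewrite ?sqr_ge0.
Qed.

Lemma dot_mulmx u v A : A^T = A -> dot (A *m u) v = dot u (A *m v).
Proof. by move=> sA; rewrite !dotE trmx_mul sA mulmxA. Qed.

Lemma quad_dot A v : (v^T *m A *m v) 0 0 = dot v (A *m v).
Proof. by rewrite dotE mulmxA. Qed.

Lemma loewner_ge_dot A a v : loewner_le a%:M A -> a * dot v v <= dot v (A *m v).
Proof.
by case=> _ /(_ v); rewrite quad_dot mulmxBl mul_scalar_mx dotDr dotNr dotZr subr_ge0.
Qed.

Lemma loewner_le_dot A a v : loewner_le A a%:M -> dot v (A *m v) <= a * dot v v.
Proof.
by case=> _ /(_ v); rewrite quad_dot mulmxBl mul_scalar_mx dotDr dotNr dotZr subr_ge0.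
Qed.

(* Add the quadratic form of [A] at [A v - b v] and that of [b I - A] at
   [A v]. *)
Lemma loewner_mulmx_sqr A a b v : 0 <= a -> 0 < b -> A^T = A ->
  loewner_le a%:M A -> loewner_le A b%:M ->
  dot (A *m v) (A *m v) <= b ^+ 2 * dot v v.
Proof.
move=> a0 b0 sA Aa Ab.
have := le_trans (mulr_ge0 a0 (dot_ge0 _)) (loewner_ge_dot _ _ (A *m v - b *: v) Aa).
have := loewner_le_dot _ _ (A *m v) Ab.
have := loewner_le_dot _ _ v Ab.
rewrite mulmxBr -scalemxAr !(dotDl, dotDr, dotNl, dotNr, dotZl, dotZr).
rewrite -[dot v (A *m (A *m v))](dot_mulmx _ _ _ sA).
move=> h3 h2 h1; rewrite -(ler_pM2l b0); nra.
Qed.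

(** Convexity of the squared norm: the squared deviations of the [D i] from their mean [e] have a
    nonnegative sum. *)
Lemma dot_mean_le (m : nat) (D : 'I_m -> 'cV[R]_n) : (0 < m)%N ->
  dot (m%:R^-1 *: \sum_i D i) (m%:R^-1 *: \sum_i D i) <=
  m%:R^-1 * \sum_i dot (D i) (D i).
Proof.
move=> m0; set e := m%:R^-1 *: _.
have m0' : 0 < m%:R :> R by rewrite ltr0n.
have eE : \sum_i D i = m%:R *: e by rewrite scalerA divff ?scale1r // gt_eqF.
have : 0 <= \sum_i dot (D i - e) (D i - e) by apply: sumr_ge0 => i _; exact: dot_ge0.
rewrite (eq_bigr (fun i => dot (D i) (D i) + (- (2 * dot e (D i)) + dot e e))).
  rewrite !big_split /= sumrN -mulr_sumr -dot_sumr eE dotZr sumr_const card_ord.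
  rewrite -mulr_natl => h; rewrite mulrC ler_pdivlMr //; lra.
by move=> i _; rewrite !(dotDl, dotDr, dotNl, dotNr) (dotC (D i) e); ring.
Qed.

End Dot.

(** * Descent lemma and the one-step inequality *)

Section Smooth.
Context {R : realType} {n : nat}.
Variables (f : 'cV[R]_n -> R) (L flow : R).
Hypotheses (L0 : 0 < L) (hf : smooth_bounded_below f L flow).

Lemma derive_dot_grad (x v : 'cV[R]_n) :
  'D_v (f : _ -> R^o) x = dot (grad f x) v.
Proof.
have [[df _] _ _] := hf.
rewrite deriveE // {1}(matrix_sum_delta v) linear_sum.
apply: eq_bigr => i _; rewrite big_ord1 linearZ /= -deriveE // mxE mulrC.
by [].
Qed.

Lemma is_derive_line (x v : 'cV[R]_n) (t : R) :
  is_derive t 1 (fun s : R => f (x + s *: v) : R^o) (dot (grad f (x + t *: v)) v).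
Proof.
have [[df _] _ _] := hf.
(* Moving the base point along the line gives the difference quotient of [f] at [x + t *: v] in the
   direction [v]. *)
have E : (fun h : R => h^-1 *: (f (x + (h *: (1 : R^o) + t) *: v) - f (x + t *: v)) : R^o)
   = (fun h : R => h^-1 *: (f (h *: v + (x + t *: v)) - f (x + t *: v))).
  by apply/funext => h; rewrite scalerDl addrCA [h *: 1]mulr1.
split.
  rewrite /derivable E.
  exact: (diff_derivable (df _)).
by rewrite -derive_dot_grad /derive E.
Qed.

(** Mean value theorem for [f] along the segment minus the quadratic [q]: the derivative of the
    difference is nonpositive on the open unit interval. *)
Lemma descent (x v : 'cV[R]_n) :
  f (x + v) <= f x + dot (grad f x) v + L / 2 * dot v v.
Proof.
pose a := dot (grad f x) v; pose b := L / 2 * dot v v.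
pose q : R -> R := a *: (id : R -> R) + b *: ((id : R -> R) ^+ 2).
have qE t : q t = a * t + b * t ^+ 2 by rewrite /q fctE.
pose phi : R -> R := (fun s => f (x + s *: v)) - q.
have phiE t : phi t = f (x + t *: v) - (a * t + b * t ^+ 2) by rewrite -qE.
have dphi (t : R) : is_derive t 1 phi
    (dot (grad f (x + t *: v)) v - (a + b * (2 * t))).
  have dl := is_derive_line x v t.
  rewrite /phi /q; apply: is_derive_eq.
  by rewrite /GRing.scale /= expr1; ring.
have cphi : {within `[0, 1], continuous phi}.
  apply: derivable_within_continuous => t _.
  by have [] := dphi t.
have : phi 1 <= phi 0.
  have [c c01 E] := @MVT _ phi _ 0 1 ltr01 (fun t _ => dphi t) cphi.
  move: c01; rewrite in_itv /= => /andP[c0 _].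
  rewrite -subr_le0 E subr0 mulr1 subr_le0.
  have [_ _ /(_ (x + c *: v) x)] := hf.
  rewrite addrAC subrr add0r => hL.
  have {}hL : dot (grad f (x + c *: v) - grad f x) (grad f (x + c *: v) - grad f x)
      <= (L * c) ^+ 2 * dot v v.
    have := lerXn2r 2 (norm2_ge0 _) (mulr_ge0 (ltW L0) (norm2_ge0 _)) hL.
    rewrite exprMn !norm2_sqr dotZl dotZr => /le_trans; apply.
    by rewrite le_eqVlt; apply/orP; left; apply/eqP; ring.
  have Lc : 0 < L * c by exact: mulr_gt0.
  (* With u the difference of gradients, expanding |u - L c v|^2 >= 0 under |u| <= L c |v| and
     dividing by [L * c] gives u . v <= L c |v|^2, in place of Cauchy-Schwarz. *)
  have := dot_ge0 (grad f (x + c *: v) - grad f x - (L * c) *: v).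
  move: hL; set u := grad f _ - _ => hL.
  have -> : dot (grad f (x + c *: v)) v = dot u v + dot (grad f x) v.
    by rewrite -dotDl subrK.
  clearbody u.
  rewrite !(dotDl, dotDr, dotNl, dotNr, dotZl, dotZr) (dotC v u) => h.
  rewrite /a /b; move: (dot u u) (dot u v) (dot v v) hL h => p r s hL h.
  nra.
rewrite !phiE scale1r scale0r addr0 /a /b; lra.
Qed.

(** Compare the lower bound [flow] with the descent lemma for a gradient step of size 1 / L. *)
Lemma grad_sqr_le (x : 'cV[R]_n) :
  dot (grad f x) (grad f x) <= 2 * L * (f x - flow).
Proof.
have [_ flb _] := hf.
have := descent x (- L^-1 *: grad f x).
have := flb (x + - L^-1 *: grad f x).
rewrite dotZl !dotZr.
set q := dot _ _ => h1 h2.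
have Li : L * L^-1 = 1 by rewrite divff // gt_eqF.
have := le_trans h1 h2.
have -> : L / 2 * (- L^-1 * (- L^-1 * q)) = (L * L^-1) * (L^-1 * q) / 2 by ring.
rewrite Li => h3.
have -> : q = (L * L^-1) * q by rewrite Li mul1r.
by rewrite -!mulrA (mulrCA 2) ler_pM2l //; lra.
Qed.

(* Conditionally on the past the [dot _ (D i)] have mean zero; the last sum is
   only bounded through Jensen, so no independence within a batch is used. *)
Lemma sqn_step (m : nat) (x : 'cV[R]_n) (A : 'M[R]_n) (D : 'I_m -> 'cV[R]_n)
    (a klo khi : R) :
  (0 < m)%N -> 0 < klo -> 0 < khi -> A^T = A ->
  loewner_le klo%:M A -> loewner_le A khi%:M ->
  0 < a -> a <= klo / (L * khi ^+ 2) ->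
  f (x - a *: (A *m (grad f x + m%:R^-1 *: \sum_i D i))) +
    a * klo / 2 * dot (grad f x) (grad f x) <=
  f x + m%:R^-1 * \sum_i
      dot ((L * a ^+ 2 * khi ^+ 2) *: grad f x - a *: (A *m grad f x)) (D i) +
    L / 2 * a ^+ 2 * khi ^+ 2 * (m%:R^-1 * \sum_i dot (D i) (D i)).
Proof.
move=> m0 klo0 khi0 sA Alo Ahi a0.
rewrite ler_pdivlMr ?mulr_gt0 ?exprn_gt0 // => ale.
set p := grad f x; rewrite -dot_sumr -[m%:R^-1 * dot _ _]dotZr.
have := dot_mean_le m D m0; set e := m%:R^-1 *: _ => eV.
have := descent x (- (a *: (A *m (p + e)))).
rewrite -/p; clearbody p e; rewrite dotNr dotNl dotNr opprK !dotZr !dotZl.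
have := loewner_mulmx_sqr A klo khi (p + e) (ltW klo0) khi0 sA Alo Ahi.
have := loewner_ge_dot _ _ p Alo.
rewrite -(dot_mulmx p (p + e)) // (dotDr (A *m p)) (dot_mulmx p p) //.
rewrite !(dotDl, dotDr, dotNl, dotZl) (dotC e p).
move: (dot_ge0 p) (dot_ge0 e).
move: (dot (A *m (p + e)) _) (dot p (A *m p)) (dot (A *m p) e) (dot p p) (dot p e) (dot e e) (m%:R^-1 * _) eV (f _) (f x).
move=> q s r pp pe ee V eV y1 y0 pp0 ee0 h1 h2 h3.
have c0 : 0 <= L / 2 * a ^+ 2 by rewrite mulr_ge0 ?divr_ge0 ?sqr_ge0 // ltW.
have {}h1 := ler_wpM2l (ltW a0) h1.
have {}h2 := ler_wpM2l c0 h2.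
have {}eV := ler_wpM2l (mulr_ge0 c0 (sqr_ge0 khi)) eV.
(* The step-size bound times [a * pp]: half of the decrease [a * klo * pp] absorbs the curvature
   term in [pp]. *)
have {}ale := ler_wpM2l (mulr_ge0 (ltW a0) pp0) ale.
lra.
Qed.

End Smooth.

(** * Borel measurability of matrix-valued maps *)

Section BorelMatrix.
Context {R : realType}.

Lemma continuous_measurable_borel (V : ptopologicalType) (h : V -> R) :
  continuous h -> measurable_fun setT (h : borel V -> R).
Proof.
move=> /continuousP ch; apply: (measurability _ (measurable_realfun.RGenOpens.measurableE R)).
move=> _ [_ [a [b ->] <-]]; rewrite setTI; apply: sub_sigma_algebra.
exact/ch/interval_open.
Qed.

Lemma measurable_coord {d} {T : measurableType d} {m n : nat}
    (X : T -> 'M[R]_(m, n)) i j :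
  measurable_fun setT (X : T -> borel 'M[R]_(m, n)) ->
  measurable_fun setT (fun w => X w i j).
Proof.
move=> mX.
apply: (@measurableT_comp _ _ _ _ (borel 'M[R]_(m, n)) _ (fun M => M i j)) => //.
exact: (continuous_measurable_borel 'M[R]_(m, n) (fun M => M i j) (@coord_continuous _ _ _ i j)).
Qed.

(* Every open set is a countable union of boxes with rational corners. *)
Lemma measurable_matrix {d} {T : measurableType d} {m n : nat}
    (X : T -> 'M[R]_(m, n)) :
  (forall i j, measurable_fun setT (fun w => X w i j)) ->
  measurable_fun setT (X : T -> borel 'M[R]_(m, n)).
Proof.
move=> mX; pose Q := ('M[rat]_(m, n) * 'M[rat]_(m, n))%type.
pose box (q : Q) := [set M : 'M[R]_(m, n) |
  forall i j, ratr (q.1 i j) < M i j < ratr (q.2 i j)].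
have mbox q : measurable (X @^-1` box q).
  have -> : X @^-1` box q = \big[setI/setT]_(i < m) \big[setI/setT]_(j < n)
      (fun w => X w i j) @^-1` `]ratr (q.1 i j), ratr (q.2 i j)[%classic.
    apply/seteqP; split=> w.
      move=> h; rewrite -bigcap_seq => i _; rewrite -bigcap_seq => j _.
      by rewrite /= in_itv /= h.
    rewrite -bigcap_seq => h i j.
    have /= := h i (mem_index_enum i).
    rewrite -bigcap_seq => /(_ j (mem_index_enum j)).
    by rewrite /= in_itv.
  apply: bigsetI_measurable => i _; apply: bigsetI_measurable => j _.
  by rewrite -[X in measurable X]setTI; exact: mX.
apply: (@measurability _ _ T (borel 'M[R]_(m, n)) setT X open) => //.
move=> _ [U oU <-]; rewrite setTI.
(* Rational boxes are enumerated by their codes; codes of no box and boxes not inside [U] contribute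
   the empty set. *)
pose F (k : nat) := if choice.unpickle k is Some q then
   (if `[< box q `<=` U >] then X @^-1` box q else set0) else set0.
have -> : X @^-1` U = \bigcup_k F k.
  apply/seteqP; split=> [w Uw|w [k _]]; last first.
    rewrite /F; case: choice.unpickle => // q; case: asboolP => // h.
    by move=> /h.
  have /nbhs_ballP[e e0 eU] : nbhs (X w) U by exact: open_nbhs_nbhs.
  (* Corners within [e] of the entries of [X w], so that the box lies in the sup-norm ball. *)
  have ea i j : exists q : rat, X w i j - e < ratr q < X w i j.
    have /rat_in_itvoo[q] : X w i j - e < X w i j by rewrite ltrBlDr ltrDl.
    by exists q.
  have eb i j : exists q : rat, X w i j < ratr q < X w i j + e.
    have /rat_in_itvoo[q] : X w i j < X w i j + e by rewrite ltrDl.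
    by exists q.
  pose q : Q := (\matrix_(i, j) projT1 (cid (ea i j)),
                 \matrix_(i, j) projT1 (cid (eb i j))).
  exists (choice.pickle q) => //; rewrite /F choice.pickleK.
  have bq : box q `<=` U.
    move=> M bM; apply: eU; split=> // i j.
    have := bM i j; rewrite !mxE.
    case: (cid (ea i j)) => a /= /andP[a1 a2].
    case: (cid (eb i j)) => b /= /andP[b1 b2] /andP[h1 h2].
    by rewrite /ball /= ltr_norml; apply/andP; split; lra.
  case: asboolP => // _ i j; rewrite !mxE.
  case: (cid (ea i j)) => a /= /andP[a1 ->].
  by case: (cid (eb i j)) => b /= /andP[-> _].
apply: bigcupT_measurable => k; rewrite /F; case: choice.unpickle => // q.
by case: ifP.
Qed.

End BorelMatrix.

(** * Independence of one variable from the sigma-algebra of others *)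

Section IndependentSigma.
Local Open Scope ereal_scope.
Context {R : realType} {d} {Omega : measurableType d} (P : probability Omega R).
Context {d'} {E : measurableType d'} {I : choiceType}.
Variable X : I -> Omega -> E.
Hypothesis mX : forall i, measurable_fun setT (X i).
Hypothesis indX : mutually_independent P X.

Let mpre i (B : set E) : measurable B -> measurable (X i @^-1` B).
Proof. by move=> mB; rewrite -[X in measurable X]setTI; exact: mX. Qed.

Lemma sigma_of_measurable (D : set I) : sigma_of D X `<=` measurable.
Proof.
apply: smallest_sub; first exact: sigma_algebra_measurable.
by move=> A [i _ [B mB <-]]; rewrite setTI; exact: mpre.
Qed.

(** A pi-system generating [sigma_of D X], on whose members mutual independence gives product
    formulas. *)
Definition cylinders (D : set I) : set (set Omega) :=
  [set A | exists (J : {fset I}) (B : I -> set E),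
    [/\ forall i, measurable (B i), [set` J] `<=` D &
        A = \bigcap_(i in [set` J]) X i @^-1` B i]].

Lemma cylinders_setI (D : set I) : setI_closed (cylinders D).
Proof.
move=> _ _ [J1 [B1 [mB1 J1D ->]]] [J2 [B2 [mB2 J2D ->]]].
(* An index missing from one of the two families is padded there with the full space. *)
exists (J1 `|` J2)%fset, (fun i => (if i \in J1 then B1 i else setT) `&`
                                   (if i \in J2 then B2 i else setT)).
split=> [i|i /=|].
- by apply: measurableI; case: ifP.
- by rewrite inE => /orP[/J1D|/J2D].
apply/seteqP; split=> w.
  by move=> [h1 h2] i /= _; split; case: ifPn => // iJ; [exact: h1|exact: h2].
move=> h; split=> i /= iJ; have := h i; rewrite /= inE iJ ?orbT => /(_ isT)[] //.
Qed.

Lemma sub_sigma_of_cylinders (D : set I) : sigma_of D X `<=` <<s cylinders D >>.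
Proof.
apply: sub_sigma_algebra2 => A [i Di [B mB <-]].
exists [fset i]%fset, (fun=> B); split=> // [j|].
  by rewrite /= inE => /eqP ->.
by rewrite setTI set_fset1 bigcap_set1.
Qed.

(** Uniqueness of measures on a pi-system: as functions of [A] both sides are finite measures, [P]
    restricted to the event on [X i] and [P] scaled by its probability, and they agree on
    [cylinders D]. *)
Lemma sigma_of_independent (D : set I) (i : I) (A : set Omega) (B : set E) :
  ~ D i -> sigma_of D X A -> measurable B ->
  P (A `&` X i @^-1` B) = P A * P (X i @^-1` B).
Proof.
move=> nDi sA mB; have mC := mpre i B mB.
have Cfin : P (X i @^-1` B) \is a fin_num by exact: fin_num_measure.
pose r : {nonneg R} := NngNum (fine_ge0 (measure_ge0 P (X i @^-1` B))).
pose m1 : {measure set Omega -> \bar R} := mrestr P mC.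
pose m2 : {measure set Omega -> \bar R} := mscale r P.
suff : m1 A = m2 A by rewrite /m1 /m2 /= /mrestr /mscale /= fineK // muleC.
apply: (g_sigma_algebra_measure_unique (cylinders D) _ (fun=> setT)).
- move=> _ [J [C [mC' _ ->]]]; apply: fin_bigcap_measurable => // j _.
  exact: mpre.
- by move=> _; exists fset0, (fun=> setT); split=> //; rewrite set_fset0 bigcap_set0.
- by rewrite bigcup_const.
- exact: cylinders_setI.
- move=> _ [J [C [mC' JD ->]]]; rewrite /m1 /m2 /= /mrestr /mscale /= fineK //.
  have iJ : i \notin J by apply/negP => /JD.
  (* As [i] is not in [J], the intersection is again a cylinder, over [J] with [i] added; [C'] gives
     its sides. *)
  pose C' j := if j == i then B else C j.
  have mC2 j : measurable (C' j) by rewrite /C'; case: ifP.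
  have CE j : j \in J -> C' j = C j.
    by move=> jJ; rewrite /C'; case: eqP => // ji; rewrite -ji jJ in iJ.
  have := indX (i |` J)%fset C' mC2.
  rewrite set_fsetU1 bigcap_setU1 big_fsetU1 //= {1 3}/C' eqxx setIC.
  rewrite (eq_bigcapr (G := fun j => X j @^-1` C j)); last first.
    by move=> j /= jJ; rewrite CE.
  move=> ->; congr (_ * _); rewrite indX //.
  by apply: eq_big_seq => j jJ; rewrite CE.
- by move=> _; rewrite /m1 /= /mrestr ltey_eq fin_num_measure // setTI.
- exact: sub_sigma_of_cylinders.
Qed.

End IndependentSigma.

(** * Fubini for an independent pair *)

Section IndependentPair.
Local Open Scope ereal_scope.
Context {R : realType} {d} {Omega : measurableType d} (P : probability Omega R).
Context {d1} {T1 : measurableType d1} {d2} {T2 : measurableType d2}.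
Variables (Y : {mfun Omega >-> T1}) (Z : {mfun Omega >-> T2}).
Hypothesis indYZ : forall A B, measurable A -> measurable B ->
  P (Y @^-1` A `&` Z @^-1` B) = P (Y @^-1` A) * P (Z @^-1` B).

Let YZ w := (Y w, Z w).
Let mYZ : measurable_fun setT YZ.
Proof. exact: measurable_fun_pair. Qed.
Let pYZ : {mfun Omega >-> (T1 * T2)%type} := mfun_Sub (mem_set mYZ).

Lemma independent_pair_law (S : set (T1 * T2)%type) : measurable S ->
  (distribution P Y \x distribution P Z) S = distribution P pYZ S.
Proof.
apply: product_measure_unique => A B mA mB.
by rewrite /distribution /pushforward /= -indYZ.
Qed.

(** Tonelli for the product law; freezing [Y] and averaging over [Z] stands for the conditional
    expectation given [Y]. *)
Lemma independent_ge0_integral (h : (T1 * T2)%type -> \bar R) :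
  measurable_fun setT h -> (forall p, 0 <= h p) ->
  \int[P]_w h (Y w, Z w) = \int[P]_w \int[distribution P Z]_s h (Y w, s).
Proof.
move=> mh h0.
transitivity (\int[distribution P pYZ]_p h p).
  by rewrite ge0_integral_distribution.
rewrite (eq_measure_integral (distribution P Y \x distribution P Z)%E); last first.
  by move=> S mS _; exact: esym (independent_pair_law _ _).
rewrite fubini_tonelli1 // ge0_integral_distribution //.
- exact: measurable_fun_fubini_tonelli_F.
- by move=> y; apply: integral_ge0.
Qed.

Lemma independent_integrable (h : (T1 * T2)%type -> \bar R) :
  measurable_fun setT h -> P.-integrable setT (fun w => h (Y w, Z w)) ->
  (distribution P Y \x distribution P Z).-integrable setT h.
Proof.
move=> mh ih; apply/integrableP; split=> //.
rewrite (eq_measure_integral (distribution P pYZ)); last first.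
  by move=> S mS _; exact: independent_pair_law.
rewrite ge0_integral_distribution //; last exact: measurableT_comp.
by move/integrableP : ih => [].
Qed.

Lemma independent_integral (h : (T1 * T2)%type -> \bar R) :
  measurable_fun setT h -> P.-integrable setT (fun w => h (Y w, Z w)) ->
  \int[P]_w h (Y w, Z w) = \int[P]_w \int[distribution P Z]_s h (Y w, s).
Proof.
move=> mh ih; have ih' := independent_integrable h mh ih.
transitivity (\int[distribution P pYZ]_p h p).
  by rewrite integral_distribution.
rewrite (eq_measure_integral (distribution P Y \x distribution P Z)%E); last first.
  by move=> S mS _; exact: esym (independent_pair_law _ _).
rewrite -integral12_prod_meas1 // integral_distribution //.
- exact: (measurable_fubini_F ih').
- have /integrableP[mF fF] := integrable_fubini_F ih'.
  apply/integrableP; split; first exact: measurableT_comp.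
  by move: fF; rewrite ge0_integral_distribution //; exact: measurableT_comp.
Qed.

(* The centering is assumed [P]-almost everywhere along [Y]: the exceptional
   null set need not be the preimage of a measurable subset of [T1]. *)
Lemma independent_centered (U : T1 -> R) (D : (T1 * T2)%type -> R) :
  measurable_fun setT U -> measurable_fun setT D ->
  \int[P]_w (U (Y w) ^+ 2)%:E < +oo ->
  \int[P]_w (D (Y w, Z w) ^+ 2)%:E < +oo ->
  {ae P, forall w, (distribution P Z).-integrable setT (fun s => (D (Y w, s))%:E) /\
    \int[distribution P Z]_s (D (Y w, s))%:E = 0} ->
  P.-integrable setT (fun w => (U (Y w) * D (Y w, Z w))%:E) /\
  \int[P]_w (U (Y w) * D (Y w, Z w))%:E = 0.
Proof.
move=> mU mD U2 D2 D0.
have mUY : measurable_fun setT (U \o Y) by exact: measurableT_comp.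
have mDYZ : measurable_fun setT (D \o YZ) by exact: measurableT_comp.
have i1 : P.-integrable setT (fun w => (U (Y w) * D (Y w, Z w))%:E).
  (* The domination |U D| <= U^2 + D^2 makes the product integrable. *)
  have i2 : P.-integrable setT (fun w => (U (Y w) ^+ 2 + D (Y w, Z w) ^+ 2)%:E).
    apply: (@integrableD _ _ _ _ _ _ (fun w => (U (Y w) ^+ 2)%:E)
      (fun w => (D (Y w, Z w) ^+ 2)%:E)) => //.
    - apply/integrableP; split.
        by apply/measurable_EFinP; exact: (measurable_funX 2 mUY).
      by under eq_integral do rewrite gee0_abs ?lee_fin ?sqr_ge0 //.
    - apply/integrableP; split.
        by apply/measurable_EFinP; exact: (measurable_funX 2 mDYZ).
      by under eq_integral do rewrite gee0_abs ?lee_fin ?sqr_ge0 //.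
  apply: le_integrable i2 => //.
    by apply/measurable_EFinP; exact: (measurable_funM mUY mDYZ).
  move=> w _; rewrite /= lee_fin normrM [leRHS]ger0_norm ?addr_ge0 ?sqr_ge0 //.
  rewrite -(real_normK (num_real (U _))) -(real_normK (num_real (D _))).
  by have := normr_ge0 (U (Y w)); have := normr_ge0 (D (Y w, Z w)); nra.
split=> //.
pose h (p : (T1 * T2)%type) := (U p.1 * D p)%:E.
have mh : measurable_fun setT h.
  apply/measurable_EFinP; apply: measurable_funM => //.
  exact: measurableT_comp.
rewrite (independent_integral h mh i1).
rewrite (ae_eq_integral (cst 0)) ?integral0 //.
- have mF := measurable_fubini_F (independent_integrable h mh i1).
  exact: (measurableT_comp mF).
- apply: filterS D0 => w [iD E0] _ /=.
  under eq_integral do rewrite /h /= EFinM.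
  by rewrite integralZl // E0 mule0.
Qed.

End IndependentPair.

(** * Vanishing liminf from a convergent weighted series *)

Section LiminfWeighted.
Context {R : realType}.
Local Open Scope ereal_scope.

(** Every tail infimum is zero: if one exceeded e > 0, the weighted series would dominate c e^2
    times a tail of the divergent series of the [a k]. *)
Lemma limn_einf_weighted_eq0 (a u : nat -> R) (c : R) :
  (0 < c)%R -> (forall k, 0 <= a k)%R -> (forall k, 0 <= u k)%R ->
  \sum_(0 <= k <oo) (a k)%:E = +oo ->
  \sum_(0 <= k <oo) (a k * c * u k ^+ 2)%:E < +oo ->
  limn_einf (fun k => (u k)%:E) = 0.
Proof.
move=> c0 a0 u0 aoo uoo; rewrite limn_einf_lim.
suff -> : einfs (fun k => (u k)%:E) = cst 0 by exact: lim_cst.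
apply/funext => N; apply/eqP; rewrite eq_le; apply/andP; split; last first.
  by apply: le_ereal_inf_tmp => _ [k _ <-]; rewrite lee_fin.
apply/lee_addgt0Pr => e e0; rewrite add0e leNgt; apply/negP => eu.
have {}eu k : (N <= k)%N -> (e <= u k)%R.
  move=> Nk; rewrite -lee_fin; apply: (le_trans (ltW eu)).
  by apply: ereal_inf_lbound; exists k.
have ce : (0 < c * e ^+ 2)%R by rewrite mulr_gt0 ?exprn_gt0.
have p0 k : (0 <= a k * c * u k ^+ 2)%R by rewrite !mulr_ge0 // ltW.
move: aoo; rewrite (nneseries_split 0 N) ?add0n => [|k _]; last by rewrite lee_fin.
apply/eqP; rewrite lt_eqF // lte_add_pinfty //.
  by rewrite sumEFin ltry.
have : \sum_(N <= k <oo) ((c * e ^+ 2)%:E * (a k)%:E) < +oo.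
  apply: (@le_lt_trans _ _ (\sum_(N <= k <oo) (a k * c * u k ^+ 2)%:E)).
    rewrite eseries_cond [leRHS]eseries_cond; apply: lee_nneseries => k /=.
      by move=> _ _; rewrite -EFinM lee_fin mulr_ge0 // ltW.
    move=> Nk; rewrite -EFinM lee_fin mulrC -mulrA.
    by rewrite ler_wpM2l // ler_pM2l // lerXn2r ?nnegrE ?(ltW e0) ?eu.
  move: uoo; rewrite (nneseries_split 0 N) ?add0n => [|k _]; last by rewrite lee_fin.
  apply: le_lt_trans; rewrite leeDr // sumEFin lee_fin.
  by apply: sumr_ge0.
rewrite nneseriesZl => [|k _]; last by rewrite lee_fin.
move=> h; rewrite ltNge leye_eq; apply/negP => /eqP S; move: h.
by rewrite S gt0_muley ?lte_fin // ltxx.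
Qed.

End LiminfWeighted.

(** * Upper bounds on expectations *)

Section MeanLe.
Local Open Scope ereal_scope.
Context {R : realType} {d} {T : measurableType d} (P : {measure set T -> \bar R}).

(** Integrability is kept with the bound, so that bounds add up even for functions without a sign,
    such as the linear noise term. *)
Definition mean_le (h : T -> R) (c : R) : Prop :=
  P.-integrable setT (EFin \o h) /\ \int[P]_w (h w)%:E <= c%:E.

Lemma mean_leD (h1 h2 : T -> R) (c1 c2 : R) :
  mean_le h1 c1 -> mean_le h2 c2 ->
  mean_le (fun w => h1 w + h2 w)%R (c1 + c2)%R.
Proof.
move=> [i1 l1] [i2 l2]; split.
  by have := integrableD measurableT i1 i2; apply: eq_integrable.
rewrite -[X in X <= _]/(\int[P]_w ((h1 w)%:E + (h2 w)%:E)).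
by rewrite (integralD _ i1 i2) // EFinD leeD.
Qed.

Lemma mean_leZ (a : R) (h : T -> R) (c : R) : (0 <= a)%R ->
  mean_le h c -> mean_le (fun w => a * h w)%R (a * c)%R.
Proof.
move=> a0 [i l]; split.
  by have := integrableZl measurableT a i; apply: eq_integrable.
rewrite -[X in X <= _]/(\int[P]_w (a%:E * (h w)%:E)).
by rewrite integralZl // EFinM lee_wpmul2l.
Qed.

Lemma mean_le_sum (I : Type) (s : seq I) (h : I -> T -> R) (c : I -> R) :
  (forall i, mean_le (h i) (c i)) ->
  mean_le (fun w => \sum_(i <- s) h i w)%R (\sum_(i <- s) c i)%R.
Proof.
move=> hh; elim: s => [|i s ih].
  rewrite big_nil; under eq_fun do rewrite big_nil; split.
    exact: integrable0.
  by rewrite integral0.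
by rewrite big_cons; under eq_fun do rewrite big_cons; exact: mean_leD.
Qed.

Lemma mean_le_le (h : T -> R) (c c' : R) : (c <= c')%R ->
  mean_le h c -> mean_le h c'.
Proof. by move=> cc [i l]; split=> //; apply: (le_trans l); rewrite lee_fin. Qed.

(** Turns an almost sure inequality into one between means; the integrability of [h1] comes from its
    sign and from that of [h2]. *)
Lemma mean_le_ae (h1 h2 : T -> R) (c : R) :
  measurable_fun setT h1 -> (forall w, 0 <= h1 w)%R ->
  {ae P, forall w, (h1 w <= h2 w)%R} -> mean_le h2 c -> mean_le h1 c.
Proof.
move=> m1 h1_ge0 h12 [i2 l2].
have m2 : measurable_fun setT (EFin \o h2) by exact: measurable_int i2.
have le12 : \int[P]_w (h1 w)%:E <= \int[P]_w (h2 w)%:E.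
  (* [h2] is known to be nonnegative only almost everywhere, so its absolute value replaces it. *)
  have -> : \int[P]_w (h2 w)%:E = \int[P]_w `|(h2 w)%:E|.
    apply: ae_eq_integral => //; first exact: measurableT_comp.
    apply: filterS h12 => w h12 _ /=; rewrite ger0_norm //.
    exact: le_trans (h1_ge0 w) h12.
  apply: ae_ge0_le_integral => //.
  - by move=> w _; rewrite lee_fin.
  - exact/measurable_EFinP.
  - exact: measurableT_comp.
  - apply: filterS h12 => w h12 _ /=; rewrite lee_fin.
    exact: le_trans h12 (ler_norm _).
split; last exact: le_trans le12 l2.
apply/integrableP; split; first exact/measurable_EFinP.
under eq_integral do rewrite /= ger0_norm //.
by apply: (le_lt_trans le12); apply: (le_lt_trans l2); rewrite ltry.
Qed.

End MeanLe.

Lemma mean_le_cst {R : realType} {d} {T : measurableType d} (P : probability T R)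
    (c : R) : mean_le P (fun=> c) c.
Proof.
split; first exact: finite_measure_integrable_cst.
rewrite -[X in (X <= _)%E]/(\int[P]_w cst c%:E w)%E integral_cst //.
by rewrite [X in (_ * X <= _)%E]probability_setT mule1.
Qed.

(** * Adaptedness, noise estimates and energy argument for the iteration *)

Section SQNAnalysis.
Context {R : realType} {dO} {Omega : measurableType dO}.
Context (P : probability Omega R) {n d m : nat}.
Context (f : 'cV[R]_n -> R) (g : 'cV[R]_n -> 'cV[R]_d -> 'cV[R]_n).
Hypothesis mg : measurable_fun setT
  ((fun p => g p.1 p.2) : borel 'cV[R]_n * borel 'cV[R]_d -> borel 'cV[R]_n).
Hypothesis m0 : (0 < m)%N.
Context (xi : nat -> 'I_m -> {RV P >-> borel 'cV[R]_d}).
Context (x1 : 'cV[R]_n) (H1 : 'M[R]_n) (alpha : nat -> R).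
Hypothesis alpha0 : forall k, 0 < alpha k.
Context (H : nat -> Omega -> 'M[R]_n) (x : nat -> Omega -> 'cV[R]_n).
Hypothesis hx : sqn_iteration g xi H x x1 H1 alpha.
Context (L flow sigma klo khi : R).
Hypotheses (L0 : 0 < L) (klo0 : 0 < klo) (khi0 : 0 < khi).
Hypothesis hf : smooth_bounded_below f L flow.
Hypothesis indep : mutually_independent P (all_samples xi).
Hypothesis unbiased : unbiased_oracle f g xi x.
Hypothesis variance : bounded_variance_oracle f g xi x sigma.
Hypothesis metrics : bounded_metrics P H klo khi.
Hypothesis nonanticipating : nonanticipating_metrics xi H.
Hypothesis step : forall k, alpha k <= klo / (L * khi ^+ 2).

(* Generators of the sigma-algebra of the samples drawn before iteration [k]. *)
Definition history (k : nat) : set (set Omega) :=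
  \bigcup_(p in [set p : nat * 'I_m | (p.1 < k)%N])
    preimage_set_system setT (all_samples xi p) measurable.

Notation OmF k := (g_sigma_algebraType (history k)).

Lemma measurable_all_samples p : measurable_fun setT (all_samples xi p).
Proof. exact: measurable_funPT. Qed.

Lemma measurable_history k : measurable_fun setT (id : Omega -> OmF k).
Proof.
move=> _ A mA; rewrite setTI.
exact: (sigma_of_measurable _ measurable_all_samples _ _ mA).
Qed.

(** The identity of [Omega], seen as a random variable valued in the coarser space [OmF k]:
    functions of the past are functions of it, and it forms a pair with a sample. *)
Definition past k : {mfun Omega >-> OmF k} := mfun_Sub (mem_set (measurable_history k)).

(** The index [(k, i)] is not among those of the past, whose first component is below [k]. *)
Lemma past_independent k i (A : set (OmF k)) (B : set (borel 'cV[R]_d)) :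
  measurable A -> measurable B ->
  P (past k @^-1` A `&` xi k i @^-1` B) =
    (P (past k @^-1` A) * P (xi k i @^-1` B))%E.
Proof.
move=> mA mB.
apply: (sigma_of_independent P _ measurable_all_samples indep
  [set p | (p.1 < k)%N] (k, i) A B) => //=.
by rewrite ltnn.
Qed.

Lemma measurable_history_mono k {d'} {T : measurableType d'} (h : Omega -> T) :
  measurable_fun setT (h : OmF k -> T) -> measurable_fun setT (h : OmF k.+1 -> T).
Proof.
move=> mh _ B mB.
have sub : history k `<=` history k.+1.
  by move=> A [p /= pk hA]; exists p => //=; exact: ltnW.
exact: (sub_sigma_algebra2 sub (mh measurableT B mB)).
Qed.

Lemma measurable_sample_history k i :
  measurable_fun setT (xi k i : OmF k.+1 -> borel 'cV[R]_d).
Proof.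
move=> _ B mB; apply: sub_sigma_algebra; exists (k, i) => /=; first exact: ltnSn.
by exists B.
Qed.

Lemma measurable_metric k i j :
  measurable_fun setT (fun w : OmF k => H k w i j).
Proof.
(* Nonanticipation speaks of positive indices; the initial matrix is constant. *)
case: k => [|k].
  have [_ H0 _ _] := hx.
  by apply: (eq_measurable_fun (cst (H1 i j))) => // w _; rewrite H0.
apply: measurable_coord => _ B mB; rewrite setTI.
exact: nonanticipating.
Qed.

Lemma measurable_oracle {d'} {T : measurableType d'} (y : T -> 'cV[R]_n)
    (s : T -> 'cV[R]_d) j :
  measurable_fun setT (y : T -> borel 'cV[R]_n) ->
  measurable_fun setT (s : T -> borel 'cV[R]_d) ->
  measurable_fun setT (fun w => g (y w) (s w) j 0).
Proof.
move=> my ms; apply: (measurable_coord (fun w => g (y w) (s w))).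
exact: (measurableT_comp mg (measurable_fun_pair my ms)).
Qed.

(** Adaptedness, by induction: [x k.+1] is computed from [x k], [H k] and the samples of iteration
    [k], which enter the history only at [k.+1]. *)
Lemma measurable_iterate k : measurable_fun setT (x k : OmF k -> borel 'cV[R]_n).
Proof.
have [x0 H0 _ xS] := hx.
elim: k => [|k mx].
  have -> : x 0%N = cst x1 by apply/funext => w; rewrite x0.
  exact: measurable_cst.
apply: measurable_matrix => j l; rewrite ord1.
suff : measurable_fun setT (fun w : OmF k.+1 => x k w j 0 - alpha k * \sum_t
   (H k w j t * (m%:R^-1 * \sum_i g (x k w) (xi k i w) t 0))).
  apply: eq_measurable_fun => w _; rewrite xS !mxE; congr (_ - _ * _).
  by apply: eq_bigr => t _; rewrite !mxE summxE.
have mx' := measurable_history_mono k _ mx.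
apply: measurable_funB; first exact: (@measurable_coord _ _ (OmF k.+1) _ _ (x k) j 0 mx').
apply: measurable_funM => //; apply: measurable_sum => t.
apply: measurable_funM.
  by apply: (measurable_history_mono k (fun w => H k w j t)); exact: measurable_metric.
apply: measurable_funM => //; apply: measurable_sum => i.
by apply: measurable_oracle => //; exact: measurable_sample_history.
Qed.

Lemma measurable_grad {d'} {T : measurableType d'} (y : T -> 'cV[R]_n) j :
  measurable_fun setT (y : T -> borel 'cV[R]_n) ->
  measurable_fun setT (fun w => grad f (y w) j 0).
Proof.
move=> my; have [[_ df] _ _] := hf.
apply: (eq_measurable_fun (fun w => 'D_(delta_mx j 0) (f : _ -> R^o) (y w))).
  by move=> w _; rewrite mxE.
have := continuous_measurable_borel 'cV[R]_n _ (df (delta_mx j 0)).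
by move/measurableT_comp; apply.
Qed.

Lemma measurable_objective {d'} {T : measurableType d'} (y : T -> 'cV[R]_n) :
  measurable_fun setT (y : T -> borel 'cV[R]_n) ->
  measurable_fun setT (fun w => f (y w)).
Proof.
move=> my; have [[df _] _ _] := hf.
have cf : continuous f by move=> z; exact: differentiable_continuous.
have := continuous_measurable_borel 'cV[R]_n _ cf.
by move/measurableT_comp; apply.
Qed.

Lemma measurable_dot {d'} {T : measurableType d'} (u v : T -> 'cV[R]_n) :
  (forall j, measurable_fun setT (fun w => u w j 0)) ->
  (forall j, measurable_fun setT (fun w => v w j 0)) ->
  measurable_fun setT (fun w => dot (u w) (v w)).
Proof. by move=> mu mv; apply: measurable_sum => j; exact: measurable_funM. Qed.

Definition noise k i (w : Omega) : 'cV[R]_n := g (x k w) (xi k i w) - grad f (x k w).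

Lemma measurable_noise k j :
  measurable_fun setT (fun p : (OmF k * borel 'cV[R]_d)%type =>
    (g (x k p.1) p.2 - grad f (x k p.1)) j 0).
Proof.
have mx1 : measurable_fun setT
    ((fun p => x k p.1) : (OmF k * borel 'cV[R]_d)%type -> borel 'cV[R]_n).
  exact: (measurableT_comp (measurable_iterate k)).
suff : measurable_fun setT (fun p : (OmF k * borel 'cV[R]_d)%type =>
    g (x k p.1) p.2 j 0 - grad f (x k p.1) j 0).
  by apply: eq_measurable_fun => w _; rewrite !mxE.
apply: measurable_funB; last exact: (measurable_grad _ j mx1).
exact: (measurable_oracle _ _ j mx1 measurable_snd).
Qed.

Lemma measurable_past k {d'} {T : measurableType d'} (h : Omega -> T) :
  measurable_fun setT (h : OmF k -> T) -> measurable_fun setT h.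
Proof. by move=> mh; exact: (measurableT_comp mh (measurable_history k)). Qed.

(** Tonelli freezes the past; the inner integral over the sample is then almost surely at most
    [sigma ^+ 2]. *)
Lemma noise_variance k i :
  mean_le P (fun w => dot (noise k i w) (noise k i w)) (sigma ^+ 2).
Proof.
pose h (p : (OmF k * borel 'cV[R]_d)%type) : \bar R :=
  (dot (g (x k p.1) p.2 - grad f (x k p.1)) (g (x k p.1) p.2 - grad f (x k p.1)))%:E.
have mh : measurable_fun setT h.
  by apply/measurable_EFinP; apply: measurable_dot => j; exact: measurable_noise.
have h0 p : (0 <= h p)%E by rewrite lee_fin dot_ge0.
have le : (\int[P]_w h (past k w, xi k i w) <= (sigma ^+ 2)%:E)%E.
  rewrite (independent_ge0_integral _ _ _ (past_independent k i)) //.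
  rewrite -[leRHS]mule1 -(@probability_setT _ _ _ P) -integral_cst //.
  apply: ae_ge0_le_integral => //.
  - by move=> w _; apply: integral_ge0.
  - have mF := measurable_fun_fubini_tonelli_F (m2 := distribution P (xi k i)) h mh h0.
    exact: (measurableT_comp mF).
  - by move=> w _; rewrite lee_fin sqr_ge0.
  - apply: filterS (variance k i) => w + _; rewrite unlock.
    by under eq_integral do rewrite norm2_sqr.
split=> //; apply/integrableP; split.
  have := measurableT_comp mh (measurable_fun_pair (measurable_funPT (past k)) (measurable_funPT (xi k i))).
  exact.
under eq_integral do rewrite /= ger0_norm ?dot_ge0 //.
by apply: (le_lt_trans le); rewrite ltry.
Qed.

(** The shift by [flow] makes this nonnegative, as [mean_le_ae] requires. *)
Definition gap k w : R := f (x k w) - flow.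

Lemma gap_ge0 k w : 0 <= gap k w.
Proof. by have [_ h _] := hf; rewrite subr_ge0. Qed.

Definition gradk k w : 'cV[R]_n := grad f (x k w).

(** The coefficient of the noise in [sqn_step], a function of the past alone. *)
Definition drift k w : 'cV[R]_n :=
  (L * alpha k ^+ 2 * khi ^+ 2) *: gradk k w - alpha k *: (H k w *m gradk k w).

Lemma measurable_drift k j : measurable_fun setT (fun w : OmF k => drift k w j 0).
Proof.
have mx := measurable_iterate k.
suff : measurable_fun setT (fun w : OmF k => (L * alpha k ^+ 2 * khi ^+ 2) *
    grad f (x k w) j 0 - alpha k * \sum_t (H k w j t * grad f (x k w) t 0)).
  by apply: eq_measurable_fun => w _; rewrite !mxE.
apply: measurable_funB; apply: measurable_funM => //.
  exact: (measurable_grad _ _ mx).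
apply: measurable_sum => t; apply: measurable_funM; first exact: measurable_metric.
exact: (measurable_grad _ _ mx).
Qed.

(** Square integrability of the coefficient, needed for its product with the noise: its squared norm
    is at most a multiple of that of the gradient, which [grad_sqr_le] bounds by the gap. *)
Lemma drift_sqr_mean_le k c : mean_le P (gap k) c ->
  exists c', mean_le P (fun w => dot (drift k w) (drift k w)) c'.
Proof.
move=> gc.
pose a := L * alpha k ^+ 2 * khi ^+ 2; pose b := alpha k.
(* From |a p - b q|^2 <= 2 a^2 |p|^2 + 2 b^2 |q|^2, |q| <= khi |p| and |p|^2 <= 2 L gap, with p the
   gradient and q = H p. *)
pose e := (2 * a ^+ 2 + 2 * b ^+ 2 * khi ^+ 2) * (2 * L).
have e0 : 0 <= e.
  have two0 : 0 <= 2 :> R by [].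
  apply: mulr_ge0; last exact: mulr_ge0 (ltW L0).
  by have := sqr_ge0 a; have := sqr_ge0 (b * khi); rewrite exprMn; nra.
exists (e * c); apply: mean_le_ae (mean_leZ _ _ _ _ e0 gc).
- apply: measurable_dot => j;
    exact: (measurable_past k (fun w => drift k w j 0) (measurable_drift k j)).
- by move=> w; exact: dot_ge0.
- apply: filterS (metrics k) => w [lo hi].
  have [_ _ pH _] := hx; have [sH _] := pH k w.
  have Hg := loewner_mulmx_sqr _ _ _ (gradk k w) (ltW klo0) khi0 sH lo hi.
  have gg := grad_sqr_le f L flow L0 hf (x k w).
  rewrite /drift -/a -/b; move: Hg gg; rewrite -/(gradk k w) -/(gap k w).
  set p := gradk k w; set q := _ *m p; move=> Hg gg.
  have := dot_ge0 (a *: p + b *: q).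
  rewrite !(dotDl, dotDr, dotNl, dotNr, dotZl, dotZr) (dotC q p) => pq.
  have {}Hg := ler_wpM2l (sqr_ge0 b) Hg.
  have e1 : 0 <= 2 * a ^+ 2 + 2 * b ^+ 2 * khi ^+ 2.
    by have := sqr_ge0 a; have := sqr_ge0 (b * khi); rewrite exprMn; nra.
  have {}gg := ler_wpM2l e1 gg.
  rewrite /e; lra.
Qed.

(** Coordinate by coordinate, a factor known from the past multiplies a noise centered given the
    past; the bound on the gap makes the first factor square integrable. *)
Lemma drift_noise_mean k i c : mean_le P (gap k) c ->
  mean_le P (fun w => dot (drift k w) (noise k i w)) 0.
Proof.
move=> gc; have [c' [_ dc]] := drift_sqr_mean_le k c gc.
have [_ nv] := noise_variance k i.
have coord_le (v : 'cV[R]_n) j : v j 0 ^+ 2 <= dot v v.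
  rewrite /dot (bigD1 j) //= -expr2 lerDl.
  by apply: sumr_ge0 => l _; rewrite -expr2 sqr_ge0.
have h j : mean_le P (fun w => drift k w j 0 * noise k i w j 0) 0.
  pose U (w : OmF k) := drift k w j 0.
  pose D (p : (OmF k * borel 'cV[R]_d)%type) := (g (x k p.1) p.2 - grad f (x k p.1)) j 0.
  have mD : measurable_fun setT (fun w => noise k i w j 0).
    have mYZ := measurable_fun_pair (measurable_funPT (past k)) (measurable_funPT (xi k i)).
    exact: (measurableT_comp (measurable_noise k j) mYZ).
  have mU := measurable_past k _ (measurable_drift k j).
  have [|||i1 i2] := independent_centered _ _ _ (past_independent k i) U D
    (measurable_drift k j) (measurable_noise k j).
  - apply: (@le_lt_trans _ _ c'%:E); last exact: ltry.
    apply: (le_trans _ dc); apply: ge0_le_integral => //.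
    + by move=> w _; rewrite lee_fin sqr_ge0.
    + by apply/measurable_EFinP; exact: measurable_funX.
    + apply/measurable_EFinP; apply: measurable_dot => l;
        exact: (measurable_past k _ (measurable_drift k l)).
    + by move=> w _; rewrite lee_fin; exact: coord_le.
  - apply: (@le_lt_trans _ _ (sigma ^+ 2)%:E); last exact: ltry.
    apply: (le_trans _ nv); apply: ge0_le_integral => //.
    + by move=> w _; rewrite lee_fin sqr_ge0.
    + by apply/measurable_EFinP; exact: measurable_funX.
    + by have [/measurable_int] := noise_variance k i.
    + by move=> w _; rewrite lee_fin; exact: coord_le.
  - apply: filterS (unbiased k i) => w /(_ j)[ig].
    rewrite unlock => Eg.
    have ic : (distribution P (xi k i)).-integrable setT
        (fun=> (grad f (x k w) j 0)%:E).
      exact: finite_measure_integrable_cst.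
    have DE s : (D (past k w, s))%:E =
        ((g (x k w) s j 0)%:E - (grad f (x k w) j 0)%:E)%E.
      by rewrite /D !mxE.
    split; first by under eq_fun do rewrite DE; exact: integrableB.
    under eq_integral do rewrite DE.
    rewrite integralB // Eg integral_cst //.
    rewrite [X in (_ - _ * X)%E]probability_setT.
    by rewrite mule1 -EFinB subrr.
  - by split=> //; rewrite i2.
have := mean_le_sum P _ (index_enum 'I_n) _ (fun=> 0) h; rewrite big1_eq; exact.
Qed.

Lemma sqn_step_ae k : {ae P, forall w,
  gap k.+1 w + alpha k * (klo / 2) * norm2 (gradk k w) ^+ 2 <=
  gap k w + (m%:R^-1 * \sum_i dot (drift k w) (noise k i w) +
    L / 2 * alpha k ^+ 2 * khi ^+ 2 *
      (m%:R^-1 * \sum_i dot (noise k i w) (noise k i w)))}.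
Proof.
have [_ _ pH xS] := hx.
apply: filterS (metrics k) => w [lo hi].
have [sH _] := pH k w.
have := sqn_step f L flow L0 hf m (x k w) (H k w) (fun i => noise k i w)
  (alpha k) klo khi m0 klo0 khi0 sH lo hi (alpha0 k) (step k).
(* Averaging the [m] copies of the true gradient gives it back, so the batch gradient is the
   gradient plus the mean noise. *)
have -> : grad f (x k w) + m%:R^-1 *: \sum_i noise k i w =
    batch_grad g xi x k w.
  rewrite /noise sumrB sumr_const card_ord scalerBr -[grad f _ *+ _]scaler_nat scalerA mulVf.
    by rewrite scale1r subrKC.
  by rewrite pnatr_eq0 -lt0n.
rewrite -xS norm2_sqr /gap /drift /gradk; lra.
Qed.

(** A Lyapunov function: the gap plus the decrease accumulated so far. Both parts are nonnegative,
    so a bound on its mean controls each of them. *)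
Definition energy K w : R :=
  gap K w + \sum_(k < K) alpha k * (klo / 2) * norm2 (gradk k w) ^+ 2.

Definition energy_bound K : R :=
  f x1 - flow + L / 2 * khi ^+ 2 * sigma ^+ 2 * \sum_(k < K) alpha k ^+ 2.

Lemma measurable_gap k : measurable_fun setT (gap k).
Proof.
apply: measurable_funB => //; apply: measurable_past.
exact: measurable_objective (measurable_iterate k).
Qed.

Lemma measurable_gradk_sqr k : measurable_fun setT (fun w => norm2 (gradk k w) ^+ 2).
Proof.
suff : measurable_fun setT (fun w => dot (gradk k w) (gradk k w)).
  by apply: eq_measurable_fun => w _; rewrite norm2_sqr.
by apply: measurable_dot => j; apply: measurable_past;
  exact: measurable_grad (measurable_iterate k).
Qed.

Lemma weighted_grad_ge0 k w : 0 <= alpha k * (klo / 2) * norm2 (gradk k w) ^+ 2.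
Proof. by rewrite mulr_ge0 ?sqr_ge0 // mulr_ge0 ?divr_ge0 // ltW. Qed.

Lemma measurable_energy K : measurable_fun setT (energy K).
Proof.
apply: measurable_funD; first exact: measurable_gap.
apply: measurable_sum => k; apply: measurable_funM => //.
exact: measurable_gradk_sqr.
Qed.

Lemma gap_le_energy K w : gap K w <= energy K w.
Proof. by rewrite lerDl sumr_ge0 // => k _; exact: weighted_grad_ge0. Qed.

(** Induction by taking means in the one-step inequality: the linear term contributes zero and the
    squared noise a multiple of alpha_k^2. *)
Lemma energy_mean_le K : mean_le P (energy K) (energy_bound K).
Proof.
elim: K => [|k ih].
  have [x0 _ _ _] := hx.
  rewrite /energy_bound big_ord0 mulr0 addr0.
  have -> : energy 0 = cst (f x1 - flow).
    by apply/funext => w; rewrite /energy big_ord0 addr0 /gap x0.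
  exact: mean_le_cst.
(* The induction hypothesis makes the gap integrable, which [drift_noise_mean] needs at this
   iteration. *)
have gk : mean_le P (gap k) (energy_bound k).
  apply: mean_le_ae ih; [exact: measurable_gap|exact: gap_ge0|].
  by apply: aeW => w; exact: gap_le_energy.
have mi : 0 <= m%:R^-1 :> R by rewrite invr_ge0.
have h1 := mean_leZ P _ _ _ mi (mean_le_sum P _ (index_enum 'I_m) _ _
  (fun i => drift_noise_mean k i _ gk)).
have h2 := mean_leZ P _ _ _ mi (mean_le_sum P _ (index_enum 'I_m) _ _
  (noise_variance k)).
have c0 : 0 <= L / 2 * alpha k ^+ 2 * khi ^+ 2.
  by rewrite mulr_ge0 ?sqr_ge0 // mulr_ge0 ?sqr_ge0 // divr_ge0 // ltW.
have h3 := mean_leD P _ _ _ _ ih (mean_leD P _ _ _ _ h1 (mean_leZ P _ _ _ c0 h2)).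
apply: (mean_le_le P _ _ _ _ (mean_le_ae P _ _ _ _ _ _ h3)).
- rewrite /energy_bound big_ord_recr /= big1_eq mulr0 add0r sumr_const card_ord.
  (* The [m] copies of the variance bound cancel against the factor 1 / m. *)
  rewrite -(mulr_natl (sigma ^+ 2)) (mulKf _ (sigma ^+ 2)) ?pnatr_eq0 -?lt0n //.
  lra.
- exact: measurable_energy.
- by move=> w; apply: le_trans (gap_le_energy _ _); exact: gap_ge0.
- apply: filterS (sqn_step_ae k) => w.
  rewrite /energy big_ord_recr /=; lra.
Qed.

Hypothesis alpha_sum : (\sum_(0 <= k <oo) (alpha k)%:E = +oo)%E.
Hypothesis alpha_sqr_sum : (\sum_(0 <= k <oo) (alpha k ^+ 2)%:E < +oo)%E.

Lemma energy_bounded : exists M, forall K, mean_le P (energy K) M.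
Proof.
pose S := fine (\sum_(0 <= k <oo) (alpha k ^+ 2)%:E)%E.
have SE : (\sum_(0 <= k <oo) (alpha k ^+ 2)%:E = S%:E)%E.
  rewrite fineK // ge0_fin_numE // nneseries_ge0 // => k _ _.
  by rewrite lee_fin sqr_ge0.
exists (f x1 - flow + L / 2 * khi ^+ 2 * sigma ^+ 2 * S) => K.
apply: mean_le_le (energy_mean_le K); rewrite lerD2l ler_wpM2l //.
  by rewrite mulr_ge0 ?sqr_ge0 // mulr_ge0 ?sqr_ge0 // divr_ge0 // ltW.
rewrite -lee_fin -SE -sumEFin -(big_mkord xpredT (fun k => (alpha k ^+ 2)%:E)).
by apply: nneseries_lim_ge => k _ _; rewrite lee_fin sqr_ge0.
Qed.

(** By monotone convergence the weighted series of squared gradients has mean at most [M], hence is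
    finite almost surely, and [limn_einf_weighted_eq0] applies pathwise with c = klo / 2. *)
Lemma liminf_grad_eq0 :
  {ae P, forall w, limn_einf (fun k => (norm2 (gradk k w))%:E) = 0%E}.
Proof.
have [M hM] := energy_bounded.
pose q k w : \bar R := (alpha k * (klo / 2) * norm2 (gradk k w) ^+ 2)%:E.
have q0 k w : (0 <= q k w)%E by rewrite lee_fin weighted_grad_ge0.
have mq k : measurable_fun setT (q k).
  apply/measurable_EFinP; apply: measurable_funM => //.
  exact: measurable_gradk_sqr.
have iq : P.-integrable setT (fun w => \sum_(0 <= k <oo) q k w)%E.
  apply/integrableP; split.
    by apply: (ge0_emeasurable_sum (P := xpredT)) => // k w _ _.
  under eq_integral do rewrite gee0_abs ?nneseries_ge0 //.
  rewrite integral_nneseries //.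
  apply: (@le_lt_trans _ _ M%:E); last exact: ltry.
  apply: lime_le.
    by apply: is_cvg_nneseries => k _ _; exact: integral_ge0.
  (* Each partial sum is at most [energy K], since the gap is nonnegative. *)
  apply: nearW => K; rewrite -ge0_integral_sum //.
  have [_ le] := hM K; apply: le_trans le; apply: ge0_le_integral => //.
  - by move=> w _; apply: sume_ge0.
  - exact: emeasurable_sum.
  - by apply/measurable_EFinP; exact: measurable_energy.
  - move=> w _; rewrite /q sumEFin lee_fin big_mkord /energy lerDr.
    exact: gap_ge0.
apply: filterS (integrable_ae measurableT iq) => w /(_ I) fin.
apply: (limn_einf_weighted_eq0 alpha _ (klo / 2)) => //.
- by rewrite divr_gt0.
- by move=> k; exact: ltW.
- by move=> k; exact: norm2_ge0.
- by move: fin; rewrite ge0_fin_numE // nneseries_ge0.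
Qed.

Lemma expected_objective_bounded :
  exists Mf : R, 0 < Mf /\ forall k, ('E_P[fun w => f (x k w)] <= Mf%:E)%E.
Proof.
have [M hM] := energy_bounded.
(* The absolute value and the added one make the witness positive whatever the sign of [flow]. *)
exists (`|M + flow| + 1); split; first exact: ltr_wpDl.
move=> k; rewrite unlock.
have [ig gM] : mean_le P (gap k) M.
  apply: mean_le_ae (hM k); [exact: measurable_gap|exact: gap_ge0|].
  by apply: aeW => w; exact: gap_le_energy.
have [_ fM] := mean_leD P _ _ _ _ (conj ig gM) (mean_le_cst P flow).
apply: (@le_trans _ _ (M + flow)%:E); last first.
  by rewrite lee_fin (le_trans (ler_norm _)) // lerDl.
by under eq_integral do rewrite -[f _](subrK flow).
Qed.

End SQNAnalysis.

Theorem theorem2p1 (R : realType) (dO : measure_display)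
    (Omega : measurableType dO) (P : probability Omega R) (n d m : nat)
    (* mu is the law of the random vector of the objective *)
    (mu : probability (borel 'cV[R]_d) R) (Xi : set 'cV[R]_d)
    (hXi : {ae mu, forall s, Xi s})
    (F : 'cV[R]_n * 'cV[R]_d -> R) (hF : continuously_differentiable F)
    (f : 'cV[R]_n -> R)
    (hFint : forall y, mu.-integrable setT
       (fun s : borel 'cV[R]_d => (F (y, s))%:E))
    (hf : forall y, (f y)%:E = 'E_mu[fun s : borel 'cV[R]_d => F (y, s)]%E)
    (g : 'cV[R]_n -> 'cV[R]_d -> 'cV[R]_n)
    (hg : measurable_fun setT
       ((fun p => g p.1 p.2) :
          borel 'cV[R]_n * borel 'cV[R]_d -> borel 'cV[R]_n))
    (hm : (1 <= m)%N)
    (xi : nat -> 'I_m -> {RV P >-> borel 'cV[R]_d})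
    (hlaw : forall k i (B : set (borel 'cV[R]_d)), measurable B ->
       distribution P (xi k i) B = mu B)
    (x1 : 'cV[R]_n) (H1 : 'M[R]_n) (hH1 : posdef H1)
    (alpha : nat -> R) (halpha : forall k, 0 < alpha k)
    (H : nat -> Omega -> 'M[R]_n) (x : nat -> Omega -> 'cV[R]_n)
    (hx : sqn_iteration g xi H x x1 H1 alpha)
    (L flow : R) (hL : 0 < L) (AS1 : smooth_bounded_below f L flow)
    (sigma : R) (hsigma : 0 < sigma)
    (AS2i : independent_samples xi x)
    (AS2u : unbiased_oracle f g xi x)
    (AS2v : bounded_variance_oracle f g xi x sigma)
    (klo khi : R) (hklo : 0 < klo) (hkhi : 0 < khi)
    (AS3 : bounded_metrics P H klo khi)
    (AS4 : nonanticipating_metrics xi H)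
    (hsum : (\sum_(0 <= k <oo) (alpha k)%:E = +oo)%E)
    (hsum2 : (\sum_(0 <= k <oo) (alpha k ^+ 2)%:E < +oo)%E)
    (hstep : forall k, alpha k <= klo / (L * khi ^+ 2)) :
  {ae P, forall w, limn_einf (fun k => (norm2 (grad f (x k w)))%:E) = 0%E} /\
  (exists Mf : R, 0 < Mf /\
     forall k, ('E_P[fun w => f (x k w)] <= Mf%:E)%E).
Proof.
have [indep _] := AS2i.
split.
- exact: (liminf_grad_eq0 P f g hg hm xi x1 H1 alpha halpha H x hx L flow sigma
    klo khi hL hklo hkhi AS1 indep AS2u AS2v AS3 AS4 hstep hsum hsum2).
- exact: (expected_objective_bounded P f g hg hm xi x1 H1 alpha halpha H x hx L
    flow sigma klo khi hL hklo hkhi AS1 indep AS2u AS2v AS3 AS4 hstep hsum2).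
Qed.
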